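(* Let $\mathcal V$ be a descent category and let $f:X\to Y$ be a morphism of simplicial spaces. (a) If $n\ge0$ and $f$ is a fibration (respectively a hypercover), then the induced morphism of simplicial spaces $P_nX\to P_{\partial\Delta^n}X\times_{P_{\partial\Delta^n}Y}P_nY$ is a fibration (respectively a hypercover). (b) If $f$ is a fibration, $n>0$ and $0\le i\le n$, then the induced morphism $P_nX\to P_{\Lambda^n_i}X\times_{P_{\Lambda^n_i}Y}P_nY$ is a hypercover.
   Context: A descent category is a small category $\mathcal V$ with a subcategory of morphisms called covers such that: $\mathcal V$ has finite limits; pullbacks of covers are covers; if $f$ and $g\circ f$ are covers then $g$ is a cover. A simplicial space is a simplicial object in $\mathcal V$. For a simplicial space $X$ and a finite simplicial set $T$ (finitely many nondegenerate simplices), $\mathrm{Map}(T,X)$ is the finite limit representing simplicial maps $T\to X$; for $f:X\to Y$ and $S\subset T$, $\mathrm{Map}(S\hookrightarrow T,f)=\mathrm{Map}(S,X)\times_{\mathrm{Map}(S,Y)}\mathrm{Map}(T,Y)$. $\Lambda^n_i=\bigcup_{j\neq i}\partial_j\Delta^n$ is the horn, $\partial\Delta^n$ the boundary. For a finite simplicial set $T$, $P_TX$ is the simplicial space with $(P_TX)_m=\mathrm{Map}(T\times\Delta^m,X)$, and $P_nX=P_{\Delta^n}X$. A morphism $f:X\to Y$ is a fibration if $X_n\to\mathrm{Map}(\Lambda^n_i\hookrightarrow\Delta^n,f)$ is a cover for all $n>0$, $0\le i\le n$; a hypercover if $X_n\to\mathrm{Map}(\partial\Delta^n\hookrightarrow\Delta^n,f)$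 is a cover for all $n\ge0$. *)

(* Defs.v *)
From mathcomp Require Import all_boot.
Set Implicit Arguments. Unset Strict Implicit. Unset Printing Implicit Defensive.

Definition monotone_ffun m n (f : {ffun 'I_m.+1 -> 'I_n.+1}) : bool :=
  [forall i : 'I_m.+1, forall j : 'I_m.+1, (i <= j) ==> (f i <= f j)].

Record Dmap (m n : nat) := MkDmap {
  dfun :> {ffun 'I_m.+1 -> 'I_n.+1};
  dmono : monotone_ffun dfun }.

Lemma did_mono n : monotone_ffun [ffun i : 'I_n.+1 => i].
Proof. by apply/forallP=> i; apply/forallP=> j; rewrite !ffunE; apply/implyP. Qed.

Definition did n : Dmap n n := MkDmap (did_mono n).

Lemma dcomp_mono m n p (th : Dmap n p) (et : Dmap m n) :
  monotone_ffun [ffun i => th (et i)].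
Proof.
apply/forallP=> i; apply/forallP=> j; rewrite !ffunE; apply/implyP=> hij.
have /forallP/(_ i)/forallP/(_ j)/implyP h1 := dmono et.
have /forallP/(_ (et i))/forallP/(_ (et j))/implyP h2 := dmono th.
exact: h2 (h1 hij).
Qed.

Definition dcomp m n p (th : Dmap n p) (et : Dmap m n) : Dmap m p :=
  MkDmap (dcomp_mono th et).

Lemma dmap_eq m n (a b : Dmap m n) : (forall i, a i = b i) -> a = b.
Proof.
case: a b => [fa ha] [fb hb] /= H.
have E : fa = fb by apply/ffunP.
subst; f_equal; exact: bool_irrelevance.
Qed.

Lemma dcomp_id_r m n (s : Dmap m n) : dcomp s (did m) = s.
Proof. by apply: dmap_eq => i; rewrite /= !ffunE. Qed.

Lemma dcomp_assoc k m n p (s : Dmap n p) (th : Dmap m n) (et : Dmap k m) :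
  dcomp s (dcomp th et) = dcomp (dcomp s th) et.
Proof. by apply: dmap_eq => i; rewrite /= !ffunE. Qed.

Record sSet := MksSet {
  ss :> nat -> Type;
  sact : forall m n, Dmap m n -> ss n -> ss m;
  sact_id : forall n x, sact (did n) x = x;
  sact_comp : forall k m n (th : Dmap m n) (et : Dmap k m) x,
     sact (dcomp th et) x = sact et (sact th x) }.
Arguments sact s {m n}.

Record sSetMor (S T : sSet) := MksSetMor {
  smap :> forall k, S k -> T k;
  smap_nat : forall m n (th : Dmap m n) x,
     smap (sact S th x) = sact T th (smap x) }.
Arguments smap {S T} s k x.

Definition Delta (n : nat) : sSet :=
  @MksSet (fun k => Dmap k n) (fun m k th s => dcomp s th)
    (fun k s => dcomp_id_r s) (fun j m k th et s => dcomp_assoc s th et).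

Section SubDelta.
Variables (n : nat) (P : forall k, Dmap k n -> bool).
Hypothesis Pclosed : forall k m (th : Dmap k m) s, P s -> P (dcomp s th).

Lemma sig_eqb k (x y : {s : Dmap k n | P s}) : sval x = sval y -> x = y.
Proof. case: x y => [a ha] [b hb] /= E; subst; f_equal; exact: bool_irrelevance. Qed.

Definition subact m k (th : Dmap m k) (x : {s : Dmap k n | P s}) :
  {s : Dmap m n | P s} := exist _ (dcomp (sval x) th) (Pclosed th (svalP x)).

Lemma subact_id k x : @subact k k (did k) x = x.
Proof. by apply: sig_eqb; rewrite /= dcomp_id_r. Qed.

Lemma subact_comp j m k (th : Dmap m k) (et : Dmap j m) x :
  subact (dcomp th et) x = subact et (subact th x).
Proof. by apply: sig_eqb; rewrite /= dcomp_assoc. Qed.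

Definition SubDelta : sSet := MksSet subact_id subact_comp.

Definition SubDelta_incl : sSetMor SubDelta (Delta n) :=
  @MksSetMor SubDelta (Delta n) (fun k x => sval x) (fun m k th x => erefl).
End SubDelta.

Definition bd_pred n k (s : Dmap k n) : bool :=
  [exists j : 'I_n.+1, [forall a : 'I_k.+1, s a != j]].

Lemma bd_closed n k m (th : Dmap k m) (s : Dmap m n) :
  bd_pred s -> bd_pred (dcomp s th).
Proof.
case/existsP=> j /forallP H; apply/existsP; exists j; apply/forallP=> a.
by rewrite /= ffunE H.
Qed.

(* horn Lambda^n_i = union of the faces d_j Delta^n, j <> i, where d_j Delta^n
   consists of the simplices missing the vertex j *)
Definition horn_pred n (i : 'I_n.+1) k (s : Dmap k n) : bool :=
  [exists j : 'I_n.+1, (j != i) && [forall a : 'I_k.+1, s a != j]].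

Lemma horn_closed n (i : 'I_n.+1) k m (th : Dmap k m) (s : Dmap m n) :
  horn_pred i s -> horn_pred i (dcomp s th).
Proof.
case/existsP=> j /andP[ji /forallP H]; apply/existsP; exists j.
rewrite ji /=; apply/forallP=> a; by rewrite /= ffunE H.
Qed.

Definition Bd n : sSet := SubDelta (@bd_closed n).
Definition bd_incl n : sSetMor (Bd n) (Delta n) := SubDelta_incl (@bd_closed n).
Definition Horn n (i : 'I_n.+1) : sSet := SubDelta (@horn_closed n i).
Definition horn_incl n (i : 'I_n.+1) : sSetMor (Horn i) (Delta n) :=
  SubDelta_incl (@horn_closed n i).

Definition sprod (S T : sSet) : sSet :=
  @MksSet (fun k => (S k * T k)%type)
    (fun m k th x => (sact S th x.1, sact T th x.2))
    (fun k x => ltac:(by case: x => a b; rewrite /= !sact_id))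
    (fun j m k th et x => ltac:(by case: x => a b; rewrite /= !sact_comp)).

Record Cat := MkCat {
  Ob :> Type;
  Hom : Ob -> Ob -> Type;
  idm : forall A, Hom A A;
  comp : forall A B C, Hom B C -> Hom A B -> Hom A C;
  comp_idl : forall A B (f : Hom A B), comp (idm B) f = f;
  comp_idr : forall A B (f : Hom A B), comp f (idm A) = f;
  comp_assoc : forall A B C D (h : Hom C D) (g : Hom B C) (f : Hom A B),
      comp h (comp g f) = comp (comp h g) f }.
Arguments Hom {c}.
Arguments idm {c}.
Arguments comp {c A B C}.

Definition is_pullback (V : Cat) (A B C : V) (a : Hom A C) (b : Hom B C)
    (P : V) (p1 : Hom P A) (p2 : Hom P B) : Prop :=
  comp a p1 = comp b p2 /\
  forall (U : V) (q1 : Hom U A) (q2 : Hom U B), comp a q1 = comp b q2 ->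
    exists! h : Hom U P, comp p1 h = q1 /\ comp p2 h = q2.

Definition is_terminal (V : Cat) (T : V) : Prop :=
  forall A : V, exists! h : Hom A T, True.

Record descent := MkDescent {
  dcat :> Cat;
  cover : forall (A B : dcat), Hom A B -> Prop;
  cover_id : forall A : dcat, cover (idm A);
  cover_comp : forall (A B C : dcat) (g : Hom B C) (f : Hom A B),
      cover f -> cover g -> cover (comp g f);
  has_terminal : exists T : dcat, is_terminal T;
  has_pullbacks : forall (A B C : dcat) (a : Hom A C) (b : Hom B C),
      exists (P : dcat) (p1 : Hom P A) (p2 : Hom P B), is_pullback a b p1 p2;
  cover_pullback : forall (A B C : dcat) (a : Hom A C) (b : Hom B C)
      (P : dcat) (p1 : Hom P A) (p2 : Hom P B),
      is_pullback a b p1 p2 -> cover a -> cover p2;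
  cover_cancel : forall (A B C : dcat) (f : Hom A B) (g : Hom B C),
      cover f -> cover (comp g f) -> cover g }.
Arguments cover {d A B}.

Record sSpace (V : Cat) := MksSpace {
  sp :> nat -> V;
  spmap : forall m n, Dmap m n -> Hom (sp n) (sp m);
  spmap_id : forall n, spmap (did n) = idm (sp n);
  spmap_comp : forall k m n (th : Dmap m n) (et : Dmap k m),
      spmap (dcomp th et) = comp (spmap et) (spmap th) }.
Arguments spmap {V} s {m n}.

Record sSpMor (V : Cat) (X Y : sSpace V) := MksSpMor {
  smor :> forall n, Hom (X n) (Y n);
  smor_nat : forall m n (th : Dmap m n),
      comp (smor m) (spmap X th) = comp (spmap Y th) (smor n) }.
Arguments smor {V X Y} s n.

(* a simplicial map T -> Hom(U, X_.) , i.e. a cone over X indexed by T *)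
Definition is_cone (V : Cat) (T : sSet) (X : sSpace V) (U : V)
    (c : forall k, T k -> Hom U (X k)) : Prop :=
  forall m n (th : Dmap m n) (t : T n), c m (sact T th t) = comp (spmap X th) (c n t).

(* (M, c) represents simplicial maps T -> X, i.e. M = Map(T, X) *)
Definition IsMap (V : Cat) (T : sSet) (X : sSpace V) (M : V)
    (c : forall k, T k -> Hom M (X k)) : Prop :=
  is_cone c /\
  forall (U : V) (c' : forall k, T k -> Hom U (X k)), is_cone c' ->
    exists! h : Hom U M, forall k t, comp (c k t) h = c' k t.

Arguments IsMap {V T X} M c.

(* (M, a, b) represents Map(S -> T, f) = Map(S,X) x_{Map(S,Y)} Map(T,Y) *)
Definition IsRelMap (V : Cat) (S T : sSet) (i : sSetMor S T) (X Y : sSpace V)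
    (f : sSpMor X Y) (M : V) (a : forall k, S k -> Hom M (X k))
    (b : forall k, T k -> Hom M (Y k)) : Prop :=
  [/\ is_cone a, is_cone b,
      (forall k s, comp (f k) (a k s) = b k (i k s)) &
  forall (U : V) (a' : forall k, S k -> Hom U (X k)) (b' : forall k, T k -> Hom U (Y k)),
    is_cone a' -> is_cone b' -> (forall k s, comp (f k) (a' k s) = b' k (i k s)) ->
    exists! h : Hom U M,
      (forall k s, comp (a k s) h = a' k s) /\ (forall k t, comp (b k t) h = b' k t)].

Arguments IsRelMap {V S T} i {X Y} f M a b.

(* For a simplicial subset S of Delta^n (inclusion i), the canonical map
   X_n -> Map(S -> Delta^n, f) is a cover (for any choice of the limit). *)
Definition matching_cover (D : descent) (X Y : sSpace D) (f : sSpMor X Y)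
    (n : nat) (S : sSet) (i : sSetMor S (Delta n)) : Prop :=
  forall (M : D) a b, IsRelMap i f M a b ->
  forall h : Hom (X n) M,
    (forall k s, comp (a k s) h = spmap X (i k s)) ->
    (forall k (t : Dmap k n), comp (b k t) h = comp (f k) (spmap X t)) ->
    cover h.

Definition fibration (D : descent) (X Y : sSpace D) (f : sSpMor X Y) : Prop :=
  forall n (i : 'I_n.+1), 0 < n -> matching_cover f (horn_incl i).

Definition hypercover (D : descent) (X Y : sSpace D) (f : sSpMor X Y) : Prop :=
  forall n, matching_cover f (bd_incl n).

(* Z (with universal cones u) is P_T X : (P_T X)_m = Map(T x Delta^m, X), with
   the simplicial structure induced by the universal property. *)
Definition IsPT (V : Cat) (T : sSet) (X : sSpace V) (Z : sSpace V)
    (u : forall m j, sprod T (Delta m) j -> Hom (Z m) (X j)) : Prop :=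
  (forall m, IsMap (Z m) (u m)) /\
  (forall k m (th : Dmap k m) j (t : T j) (s : Dmap j k),
      comp (u k j (t, s)) (spmap Z th) = u m j (t, dcomp th s)).

(* g : Z -> W is (a choice of) the induced morphism
     P_T X -> P_S X x_{P_S Y} P_T Y
   for the simplicial subset i : S -> T and f : X -> Y; here Z = P_T X and
   W is the levelwise fibre product, with simplicial projections p1, p2. *)
Definition induced_path_map (D : descent) (X Y : sSpace D) (f : sSpMor X Y)
    (S T : sSet) (i : sSetMor S T) (Z W : sSpace D) (g : sSpMor Z W) : Prop :=
  exists (uTX : forall m j, sprod T (Delta m) j -> Hom (Z m) (X j))
         (ZSX : sSpace D) (uSX : forall m j, sprod S (Delta m) j -> Hom (ZSX m) (X j))
         (ZSY : sSpace D) (uSY : forall m j, sprod S (Delta m) j -> Hom (ZSY m) (Y j))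
         (ZTY : sSpace D) (uTY : forall m j, sprod T (Delta m) j -> Hom (ZTY m) (Y j))
         (p1 : sSpMor W ZSX) (p2 : sSpMor W ZTY)
         (fS : forall m, Hom (ZSX m) (ZSY m))
         (rY : forall m, Hom (ZTY m) (ZSY m)),
    [/\ IsPT uTX, IsPT uSX, IsPT uSY & IsPT uTY] /\
    [/\
        (forall m j (s : S j) (d : Dmap j m),
            comp (uSY m j (s, d)) (fS m) = comp (f j) (uSX m j (s, d))),
        (forall m j (s : S j) (d : Dmap j m),
            comp (uSY m j (s, d)) (rY m) = uTY m j (i j s, d)) &
        (forall m, is_pullback (fS m) (rY m) (p1 m) (p2 m))] /\
    (
        (forall m j (s : S j) (d : Dmap j m),
            comp (uSX m j (s, d)) (comp (p1 m) (g m)) = uTX m j (i j s, d)) /\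
        (forall m j (t : T j) (d : Dmap j m),
            comp (uTY m j (t, d)) (comp (p2 m) (g m)) = comp (f j) (uTX m j (t, d)))).

(* Main.v *)
From mathcomp Require Import all_boot.
From mathcomp Require Import zify.
From Stdlib Require Import ClassicalEpsilon FunctionalExtensionality.
Require Import Defs.
Set Implicit Arguments. Unset Strict Implicit. Unset Printing Implicit Defensive.

(** By the exponential law, the matching map of [P_n X -> P_S X x_{P_S Y} P_n Y] along
    [R -> Delta^m] is the restriction map from [Map(Delta^n x Delta^m, X)] to
    [Map(C -> Delta^n x Delta^m, f)], where [C] is the union of [S x Delta^m] and
    [Delta^n x R].  The product [Delta^n x Delta^m] is obtained from [C] by glueing finitely many
    simplices, along boundaries in general and along horns when one of [S], [R] is a boundary and
    the other one a horn.  Each glueing makes the restriction map a pullback of a matching map of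
    [f], hence a cover when [f] is a hypercover (respectively a fibration).  Simplicial subsets of
    [Delta^n x Delta^m] are handled as families of chains of the poset [[n] x [m]]. *)

(** * Relative mapping objects *)

Section RelativeCones.
Variables (D : descent) (X Y : sSpace D) (f : sSpMor X Y).

Section Subobject.
Variables (T : sSet) (K : forall k, T k -> bool).

Definition closed_pred := forall k m (th : Dmap k m) t, K t -> K (sact T th t).

(** Subobjects are boolean predicates on a fixed [T], so that several of them can be compared inside
    one simplicial set. Membership proofs are explicit arguments, and boolean irrelevance makes
    their choice immaterial. *)
Definition is_relcone (U : D) (a : forall k t, @K k t -> Hom U (X k))
    (b : forall k, T k -> Hom U (Y k)) : Prop :=
  [/\ forall m n (th : Dmap m n) t (h : K t) (h' : K (sact T th t)),
        a m _ h' = comp (spmap X th) (a n t h),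
      is_cone b &
      forall k t (h : K t), comp (f k) (a k t h) = b k t].

Definition represents (M : D) (a : forall k t, @K k t -> Hom M (X k))
    (b : forall k, T k -> Hom M (Y k)) : Prop :=
  is_relcone a b /\
  forall (U : D) a' b', @is_relcone U a' b' ->
    exists! h : Hom U M,
      (forall k t (H : K t), comp (a k t H) h = a' k t H) /\
      (forall k t, comp (b k t) h = b' k t).

Lemma relcone_precomp (M U : D) a b (h : Hom U M) : is_relcone a b ->
  is_relcone (fun k t H => comp (a k t H) h) (fun k t => comp (b k t) h).
Proof.
case=> an bn fab; split=> [m n th t H H'|m n th t|k t H].
- by rewrite (an _ _ _ _ H) comp_assoc.
- by rewrite bn comp_assoc.
- by rewrite comp_assoc fab.
Qed.

Lemma represents_uniq (M U : D) a b (h1 h2 : Hom U M) : represents a b ->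
  (forall k t (H : K t), comp (a k t H) h1 = comp (a k t H) h2) ->
  (forall k t, comp (b k t) h1 = comp (b k t) h2) -> h1 = h2.
Proof.
move=> [ab_cone univ] Ha Hb.
have [h [_ uniq]] := univ _ _ _ (relcone_precomp h2 ab_cone).
by rewrite -(uniq h1) // -(uniq h2).
Qed.
End Subobject.

Lemma represents_ext (T : sSet) (K K' : forall k, T k -> bool) (M : D) a b :
  (forall k t, K k t = K' k t) -> @represents T K M a b ->
  exists2 a' : forall k t, K' k t -> Hom M (X k), represents a' b &
    forall k t h h', a' k t h' = a k t h.
Proof.
move=> EK; have E : K = K' by do 2 apply: functional_extensionality_dep => ?.
by subst K'; exists a => // k t h h'; congr a; apply: bool_irrelevance.
Qed.

(** An isomorphism is a pullback of an identity. *)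
Lemma iso_cover (A B : D) (u : Hom A B) (v : Hom B A) :
  comp u v = idm B -> comp v u = idm A -> cover u.
Proof.
move=> uv vu; apply: (@cover_pullback D _ _ _ (idm B) (idm B) A u u); last exact: cover_id.
split=> // U q1 q2; rewrite !comp_idl => <-; exists (comp v q1); split.
  by rewrite comp_assoc uv comp_idl.
by move=> h [<- _]; rewrite comp_assoc vu comp_idl.
Qed.

(** Representing objects are unique up to isomorphism; this will identify the object reached by
    glueing with a level of a path space. *)
Lemma represents_iso (T : sSet) (K : forall k, T k -> bool) (M M' : D) a b a' b' :
  @represents T K M a b -> @represents T K M' a' b' ->
  exists u : Hom M M', [/\ cover u, forall k t H, comp (a' k t H) u = a k t H &
    forall k t, comp (b' k t) u = b k t].
Proof.
move=> rep rep'; have [u [[ua ub] _]] := proj2 rep' _ _ _ (proj1 rep).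
have [v [[va vb] _]] := proj2 rep _ _ _ (proj1 rep').
exists u; split=> //; apply: (@iso_cover _ _ u v).
  by apply: (represents_uniq rep') => [k t H|k t]; rewrite comp_assoc ?ua ?ub comp_idr.
by apply: (represents_uniq rep) => [k t H|k t]; rewrite comp_assoc ?va ?vb comp_idr.
Qed.

(* [K'] is the pushout of [K] and [Delta N] along [G], so [K']-cones are pairs of a [K]-cone and
   an [N]-simplex that agree on [G]: the restriction map is a pullback of
   [X_N -> Map(G -> Delta N, f)]. *)
Lemma attach_cell (T : sSet) (K K' : forall k, T k -> bool) N
    (G : forall k, Dmap k N -> bool) (e : T N)
    (sub : forall k t, K k t -> K' k t)
    (M : D) a b (H : D) aH bH :
  closed_pred K ->
  (forall k (s : Dmap k N), K k (sact T s e) = G k s) ->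
  K' N e ->
  (forall k t, K' k t -> K k t \/ exists s, t = sact T s e) ->
  (forall k (s s' : Dmap k N), sact T s e = sact T s' e -> s = s') ->
  @represents T K M a b -> @represents (Delta N) G H aH bH ->
  exists (M' : D) a' b' (r : Hom M' M),
    [/\ @represents T K' M' a' b',
        forall k t (h : K k t), comp (a k t h) r = a' k t (sub k t h),
        forall k t, comp (b k t) r = b' k t &
        (forall h : Hom (X N) H,
           (forall k (s : Dmap k N) (g : G k s), comp (aH k s g) h = spmap X s) ->
           (forall k (s : Dmap k N), comp (bH k s) h = comp (f k) (spmap X s)) -> cover h) ->
        cover r].
Proof.
move=> Kcl KG K'e K'cov einj repM repH.
have irr k t (h h' : K k t) : h = h' by exact: bool_irrelevance.
have irr' k t (h h' : K' k t) : h = h' by exact: bool_irrelevance.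
have [[an bn fab] univM] := repM.
have [_ univH] := repH.
have KofG k (s : Dmap k N) (g : G k s) : K k (sact T s e) by rewrite KG.
have GofK k (s : Dmap k N) (h : K k (sact T s e)) : G k s by rewrite -KG.
(* [phi] restricts a cone on [K] along [e] to the attaching region [G]. *)
have [phi [[phia phib] _]] : exists! h : Hom M H,
    (forall k (s : Dmap k N) g, comp (aH k s g) h = a k _ (KofG k s g)) /\
    (forall k (s : Dmap k N), comp (bH k s) h = b k (sact T s e)).
  apply: univH; split=> [m n th s g g'|m n th s|k s g] /=.
  - have h' : K m (sact T th (sact T s e)) by rewrite -sact_comp; apply: KofG.
    rewrite -(an _ _ _ _ _ h'); move: h' (KofG _ _ _); rewrite -sact_comp => h1 h2.
    by congr (a _ _ _).
  - by rewrite sact_comp bn.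
  - by rewrite fab.
(* [psi] is the matching map of [f] along [G]. *)
have [psi [[psia psib] _]] : exists! h : Hom (X N) H,
    (forall k (s : Dmap k N) (g : G k s), comp (aH k s g) h = spmap X s) /\
    (forall k (s : Dmap k N), comp (bH k s) h = comp (f k) (spmap X s)).
  apply: univH; split=> [m n th s g g'|m n th s|k s g] //=.
  - by rewrite spmap_comp.
  - by rewrite spmap_comp !comp_assoc smor_nat.
have [M' [p1 [p2 pb]]] := has_pullbacks psi phi.
have [sq univM'] := pb.
have agree k s (h : K k (sact T s e)) : comp (a k _ h) p2 = comp (spmap X s) p1.
  have g := GofK _ _ h.
  have := congr1 (comp (aH k s g)) sq; rewrite !comp_assoc psia phia => ->.
  by congr (comp (a _ _ _) _).
have fp1 : comp (f N) p1 = comp (b N e) p2.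
  have := congr1 (comp (bH N (did N))) sq.
  by rewrite !comp_assoc psib phib sact_id spmap_id comp_idr.
(* The new cone comes from [p2] on [K] and from [p1] on faces of [e]. Both formulas are recorded, as
   they agree by [agree] on the overlap; choice turns the existence statement into a function. *)
have /(fun E => constructive_indefinite_description _ E) [a' a'P] :
    exists a' : forall k t, K' k t -> Hom M' (X k), forall k t (h' : K' k t),
      (forall h : K k t, a' k t h' = comp (a k t h) p2) /\
      (forall s, t = sact T s e -> a' k t h' = comp (spmap X s) p1).
  suff ex k t (h' : K' k t) : exists y : Hom M' (X k),
      (forall h : K k t, y = comp (a k t h) p2) /\
      (forall s, t = sact T s e -> y = comp (spmap X s) p1).
    by exists (fun k t h' => proj1_sig (constructive_indefinite_description _ (ex k t h')))
       => k t h'; case: constructive_indefinite_description.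
  have [h|nh] := orP (orbN (K k t)).
    exists (comp (a k t h) p2); split=> [h2|s E]; first by rewrite (irr _ _ h h2).
    by subst t; apply: agree.
  have [hK|[s E]] := K'cov k t h'; first by rewrite hK in nh.
  exists (comp (spmap X s) p1); split=> [h|s2 E2]; first by rewrite h in nh.
  by rewrite (einj _ s s2) // -E.
exists M', a', (fun k t => comp (b k t) p2), p2.
have a'K k t (h : K k t) h' : a' k t h' = comp (a k t h) p2 by case: (a'P k t h').
have a'e k s h' : a' k (sact T s e) h' = comp (spmap X s) p1 by case: (a'P _ _ h') => _; apply.
have a'ee h' : a' N e h' = p1.
  by case: (a'P _ _ h') => _ /(_ (did N)); rewrite sact_id spmap_id comp_idl; apply.
split=> //; first split.
- split=> [m n th t h h'|m n th t|k t h].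
  + have [hK|[s E]] := K'cov _ _ h.
      have hK' := Kcl _ _ th _ hK.
      by rewrite (a'K _ _ hK) (a'K _ _ hK') comp_assoc -(an _ _ _ _ hK hK').
    subst t; rewrite a'e; move: h'; rewrite -sact_comp => h'.
    by rewrite a'e spmap_comp comp_assoc.
  + by rewrite bn comp_assoc.
  + have [hK|[s E]] := K'cov _ _ h; first by rewrite (a'K _ _ hK) comp_assoc fab.
    by subst t; rewrite a'e comp_assoc smor_nat -comp_assoc fp1 comp_assoc -bn.
- move=> U a2 b2 [a2n b2n fab2].
  have [q2 [[q2a q2b] q2u]] : exists! h : Hom U M,
      (forall k t (h0 : K k t), comp (a k t h0) h = a2 k t (sub _ _ h0)) /\
      (forall k t, comp (b k t) h = b2 k t).
    by apply: univM.
  have [h [[h1 h2] hu]] : exists! h : Hom U M', comp p1 h = a2 N e K'e /\ comp p2 h = q2.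
    apply: univM'; apply: (represents_uniq repH) => [k s g|k s].
      rewrite !comp_assoc psia phia q2a.
      by rewrite -(a2n _ _ _ _ _ (sub _ _ (KofG k s g))).
    rewrite !comp_assoc psib phib q2b.
    by rewrite b2n -(fab2 _ _ K'e) !comp_assoc smor_nat.
  exists h; split.
    split=> [k t h'|k t]; last by rewrite -comp_assoc h2 q2b.
    have [hK|[s E]] := K'cov _ _ h'.
      by rewrite (a'K _ _ hK) -comp_assoc h2 q2a (irr' _ _ (sub _ _ hK) h').
    by subst t; rewrite a'e -comp_assoc h1 -(a2n _ _ _ _ _ h').
  move=> h' [h'a h'b]; apply: hu; split; first by rewrite -(a'ee K'e) h'a.
  symmetry; apply: q2u; split=> [k t hK|k t]; last by rewrite comp_assoc h'b.
  by rewrite comp_assoc -(a'K _ _ hK (sub _ _ hK)) h'a.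
(* [p2] is the base change of [psi] along [phi]. *)
- by move=> cov; apply: (cover_pullback pb); apply: cov.
Qed.
End RelativeCones.

(** * Subcomplexes of nerves of finite posets *)

Lemma Dmap_mono m n (s : Dmap m n) (i j : 'I_m.+1) : i <= j -> s i <= s j.
Proof. by move=> ij; have /forallP/(_ i)/forallP/(_ j)/implyP := dmono s; apply. Qed.

Lemma Dmap_of_mono m n (s : 'I_m.+1 -> 'I_n.+1) :
  (forall i j : 'I_m.+1, i <= j -> s i <= s j) -> exists d : Dmap m n, forall i, d i = s i.
Proof.
move=> sm; have mono : monotone_ffun [ffun i => s i].
  by apply/forallP=> i; apply/forallP=> j; rewrite !ffunE; apply/implyP/sm.
by exists (MkDmap mono) => i /=; rewrite ffunE.
Qed.

Section Complexes.
Variables (P : finType) (le : rel P).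

Definition chain (A : {set P}) := [forall x in A, forall y in A, le x y || le y x].

Definition down_closed (K : {set {set P}}) :=
  forall A B : {set P}, B \subset A -> A \in K -> B \in K.

Definition add_interval (K : {set {set P}}) (R S : {set P}) :=
  K :|: [set A : {set P} | (R \subset A) && (A \subset S)].

(* Adding the interval from [R] to [S] glues the simplex [S] along the union of its faces opposite
   to the vertices in [R]: the boundary for [R = S], a horn for [R = S :\ v]. *)
Inductive extends (Q : {set P} -> {set P} -> Prop) (L : {set {set P}}) : {set {set P}} -> Prop :=
| extends_refl : extends Q L L
| extends_step (K : {set {set P}}) R S : Q R S -> R \subset S -> R \notin K ->
    (forall w, w \in R -> S :\ w \in K) ->
    extends Q L (add_interval K R S) -> extends Q L K.

Definition boundary_cell (R S : {set P}) := chain S /\ R = S.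
Definition horn_cell (R S : {set P}) := chain S /\ exists2 v, v \in S & R = S :\ v.

(** A subset of a new member either still contains [R], or misses some [w] in [R] and so lies in the
    facet [S :\ w], already in [K]. *)
Lemma add_interval_closed K (R S : {set P}) : down_closed K ->
  (forall w, w \in R -> S :\ w \in K) ->
  down_closed (add_interval K R S).
Proof.
move=> Kcl faces A B sBA; rewrite !inE => /orP[/(Kcl _ _ sBA) -> //|/andP[sRA sAS]].
have [sRB|/subsetPn[w wR wB]] := boolP (R \subset B).
  by rewrite (subset_trans sBA sAS) orbT.
by rewrite (Kcl _ _ _ (faces w wR)) // subsetD1 wB (subset_trans sBA sAS).
Qed.

(** A member of [L] outside [K] of least cardinality has all its facets in [K], so it can be glued
    along its whole boundary. The bound [d] is recorded for a later induction on dimension. *)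
Lemma boundary_extends (d : nat) (K L : {set {set P}}) :
  down_closed K -> down_closed L -> K \subset L ->
  (forall S, S \in L -> chain S /\ #|S| <= d) ->
  extends (fun R S => boundary_cell R S /\ #|S| <= d) L K.
Proof.
move=> Kcl Lcl sKL HL; have [c] := ubnP #|L :\: K|; elim: c K Kcl sKL => // c IH K Kcl sKL.
rewrite ltnS => le_c.
have [sLK|/subsetPn [S0 S0L S0K]] := boolP (L \subset K).
  have -> : K = L by apply/eqP; rewrite eqEsubset sKL.
  exact: extends_refl.
have S0LK : S0 \in L :\: K by rewrite inE S0K.
have [S] := @arg_minnP _ S0 (mem (L :\: K)) (fun A => #|A|) S0LK.
rewrite /= inE => /andP[SK SL] Smin.
have faces w : w \in S -> S :\ w \in K.
  move=> wS; apply/negPn/negP => nK; have := Smin (S :\ w).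
  by rewrite inE nK (Lcl _ _ (subsetDl _ _) SL) (cardsD1 w S) wS add1n ltnn => /(_ isT).
have [Sc Sd] := HL S SL.
apply: (extends_step (R := S) (S := S)) => //.
apply: IH; first exact: add_interval_closed.
  rewrite subUset sKL; apply/subsetP=> A; rewrite inE => /andP[_ sAS].
  exact: Lcl sAS SL.
apply: leq_trans le_c; apply: proper_card; apply/properP; split.
  by apply: setDS; apply: subsetUl.
by exists S; rewrite !inE ?SK ?SL // subxx orbT.
Qed.
End Complexes.

(** * Glueing simplices to subcomplexes of a nerve *)

Section Nerve.
Variables (T : sSet) (P : finType) (le : rel P) (vert : forall k, T k -> 'I_k.+1 -> P).

(** Characterises [T] as the nerve of [le] through its vertex maps, so that simplices and products
    of two simplices are treated alike. *)
Record nerve_of : Prop := NerveOf {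
  nerve_refl : reflexive le;
  nerve_anti : antisymmetric le;
  nerve_trans : transitive le;
  vert_act : forall m n (th : Dmap m n) t i, vert (sact T th t) i = vert t (th i);
  vert_mono : forall k (t : T k) (i j : 'I_k.+1), i <= j -> le (vert t i) (vert t j);
  vert_inj : forall k (t t' : T k), (forall i, vert t i = vert t' i) -> t = t';
  vert_surj : forall k (g : 'I_k.+1 -> P),
    (forall i j : 'I_k.+1, i <= j -> le (g i) (g j)) -> exists t : T k, forall i, vert t i = g i }.

Hypothesis nT : nerve_of.

Definition supp k (t : T k) : {set P} := [set vert t i | i : 'I_k.+1].

Lemma supp_act_sub m n (th : Dmap m n) t : supp (sact T th t) \subset supp t.
Proof. by apply/subsetP=> _ /imsetP[i _ ->]; rewrite (vert_act nT) imset_f. Qed.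

Lemma supp_chain k (t : T k) : chain le (supp t).
Proof.
apply/forall_inP=> _ /imsetP[i _ ->]; apply/forall_inP=> _ /imsetP[j _ ->].
by case: (leqP i j) => [|/ltnW] /(vert_mono nT) ->; rewrite ?orbT.
Qed.

(** Listing the chain in increasing order gives the vertices of a nondegenerate simplex. *)
Lemma chain_simplex N (S : {set P}) : chain le S -> #|S| = N.+1 ->
  exists2 e : T N, injective (vert e) & supp e = S.
Proof.
move=> Sc Sn; pose s := sort le (enum S).
have ss : sorted le s.
  apply: (@sort_sorted_in _ (mem S)); last by apply/allP=> x; rewrite mem_enum.
  by move=> x y xS yS; move/forall_inP: Sc => /(_ x xS)/forall_inP/(_ y yS).
have zs : size s = N.+1 by rewrite size_sort -cardE.
have us : uniq s by rewrite sort_uniq enum_uniq.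
have ms x : (x \in s) = (x \in S) by rewrite mem_sort mem_enum.
have [x0 _] : exists x0, x0 \in S by apply/set0Pn; rewrite -card_gt0 Sn.
have [i j ij|e eE] := @vert_surj nT N (fun i => nth x0 s i).
  by apply: (sorted_leq_nth (nerve_trans nT) (nerve_refl nT) x0 ss); rewrite ?inE ?zs ?ltn_ord.
exists e.
  by move=> i j; rewrite !eE => /eqP; rewrite nth_uniq ?zs ?ltn_ord // => /eqP/val_inj.
apply/setP=> x; rewrite -ms; apply/imsetP/idP=> [[i _ ->]|xs].
  by rewrite eE mem_nth // zs ltn_ord.
have lt : index x s < N.+1 by rewrite -zs index_mem.
by exists (Ordinal lt) => //; rewrite eE /= nth_index.
Qed.

(** Each vertex of [t] has a preimage index in [e]. The choice is monotone: an inversion would make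
    two vertices of [e] equal by antisymmetry, against injectivity. *)
Lemma face_of_supp k N (t : T k) (e : T N) : injective (vert e) -> supp t \subset supp e ->
  exists s : Dmap k N, t = sact T s e.
Proof.
move=> einj /subsetP ste.
have ex i : exists j, vert e j == vert t i.
  have /imsetP[j _ E] : vert t i \in supp e by apply: ste; apply: imset_f.
  by exists j; rewrite E.
pose s i := xchoose (ex i); have sE i : vert e (s i) = vert t i by apply/eqP/(xchooseP (ex i)).
have [i j ij|d dE] := @Dmap_of_mono k N s.
  case: (leqP (s i) (s j)) => // lt_ji; have := vert_mono nT t ij.
  rewrite -!sE => h1; have h2 := vert_mono nT e (ltnW lt_ji).
  suff /einj E : vert e (s i) = vert e (s j) by rewrite E ltnn in lt_ji.
  by apply: (nerve_anti nT); rewrite h1.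
by exists d; apply: (vert_inj nT) => i; rewrite (vert_act nT) dE sE.
Qed.

Lemma face_inj k N (e : T N) (s s' : Dmap k N) : injective (vert e) ->
  sact T s e = sact T s' e -> s = s'.
Proof.
by move=> einj E; apply: dmap_eq => i; apply: einj; rewrite -!(vert_act nT) E.
Qed.

Definition cell_pred N (e : T N) (R : {set P}) k (s : Dmap k N) : bool :=
  [exists j : 'I_N.+1, (vert e j \in R) && [forall a : 'I_k.+1, s a != j]].

(** A face of [e] whose support contains [R] cannot lie in [K], as [R] would follow by down-closure;
    a face avoiding a vertex of [R] lies in a facet that is in [K]. *)
Lemma cell_predE (K : {set {set P}}) (R S : {set P}) N (e : T N) k (s : Dmap k N) :
  down_closed K -> injective (vert e) -> supp e = S -> R \subset S -> R \notin K ->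
  (forall w, w \in R -> S :\ w \in K) ->
  (supp (sact T s e) \in K) = cell_pred e R s.
Proof.
move=> Kcl einj eS sRS RK faces; apply/idP/existsP=> [sK|[j /andP[jR /forallP sj]]].
  have /subsetPn[w wR wA] : ~~ (R \subset supp (sact T s e)).
    by apply: contra RK => /Kcl; apply.
  have /imsetP[j _ E] : w \in supp e by rewrite eS (subsetP sRS).
  exists j; rewrite -E wR; apply/forallP=> a; apply: contraNneq wA => saj.
  by rewrite E -saj; apply/imsetP; exists a => //; rewrite (vert_act nT).
apply: Kcl (faces _ jR); rewrite subsetD1 -eS supp_act_sub /=.
by apply/imsetP=> -[a _]; rewrite (vert_act nT) => /einj E; move: (sj a); rewrite E eqxx.
Qed.

Variables (D : descent) (X Y : sSpace D) (f : sSpMor X Y).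

Definition cover_pred N (G : forall k, Dmap k N -> bool) := forall (H : D) aH bH,
  @represents D X Y f (Delta N) G H aH bH -> forall h : Hom (X N) H,
  (forall k (s : Dmap k N) (g : G k s), comp (aH k s g) h = spmap X s) ->
  (forall k (s : Dmap k N), comp (bH k s) h = comp (f k) (spmap X s)) -> cover h.

Definition representable (T' : sSet) (K : forall k, T' k -> bool) :=
  exists (M : D) a b, @represents D X Y f T' K M a b.

(** Induction on the glueing steps, composing the restriction maps of [attach_cell]. The covering
    condition enters only the last clause, so the lemma also serves to construct the representing
    objects. *)
Lemma extends_represents (Q : {set P} -> {set P} -> Prop) (K L : {set {set P}}) (M : D) a b :
  (forall R S, Q R S -> chain le S) ->
  (forall R S N (e : T N), Q R S -> injective (vert e) -> supp e = S ->
     R \subset S -> R != set0 -> @representable (Delta N) (cell_pred e R)) ->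
  extends Q L K -> down_closed K -> set0 \in K ->
  @represents D X Y f T (fun k t => supp t \in K) M a b ->
  exists (M' : D) a' b' (r : Hom M' M),
    [/\ @represents D X Y f T (fun k t => supp t \in L) M' a' b',
        forall k t h h', comp (a k t h) r = a' k t h',
        forall k t, comp (b k t) r = b' k t &
        (forall R S N (e : T N), Q R S -> injective (vert e) -> supp e = S ->
           R != set0 -> cover_pred (cell_pred e R)) -> cover r].
Proof.
move=> Qchain Qrep KL; elim: KL M a b => [|{}K R S QRS sRS RK faces _ IH] M a b Kcl K0 repM.
  exists M, a, b, (idm M); split=> // [k t h h'|k t|_]; last exact: cover_id.
    by rewrite comp_idr; congr a; apply: bool_irrelevance.
  by rewrite comp_idr.
(* The empty set is in [K] and [R] is not, so [S] is nonempty and has a dimension [N]. *)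
have R0 : R != set0 by apply: contraNneq RK => ->.
have [N SN] : exists N, #|S| = N.+1.
  exists #|S|.-1; rewrite prednK // card_gt0; apply: contraNneq R0 => S0.
  by rewrite -subset0 -S0.
have [e einj eS] := chain_simplex (Qchain _ _ QRS) SN.
have [H [aH [bH repH]]] := Qrep _ _ _ _ QRS einj eS sRS R0.
have sub k (t : T k) : supp t \in K -> supp t \in add_interval K R S by rewrite inE => ->.
have [|||||M1 [a1 [b1 [r1 [rep1 a1E b1E cov1]]]]] := attach_cell (e := e) sub _ _ _ _ _ repM repH.
- by move=> k m th t; apply: Kcl; apply: supp_act_sub.
- by move=> k s; apply: (cell_predE s Kcl einj eS sRS RK faces).
- by rewrite !inE eS sRS subxx orbT.
- move=> k t; rewrite !inE => /orP[tK|/andP[_ tS]]; [by left | right].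
  by apply: face_of_supp => //; rewrite eS.
- by move=> k s s'; apply: face_inj.
have [||M2 [a2 [b2 [r2 [rep2 a2E b2E cov2]]]]] := IH M1 a1 b1 _ _ rep1.
- exact: add_interval_closed.
- by rewrite inE K0.
exists M2, a2, b2, (comp r1 r2); split=> // [k t h h'|k t|cov].
- by rewrite comp_assoc a1E; apply: a2E.
- by rewrite comp_assoc b1E.
- by apply: cover_comp; [exact: cov2 | apply: cov1; apply: (cov _ _ _ _ QRS)].
Qed.
End Nerve.

(** * Filling the product of a boundary and a horn *)

Section Prism.
Variables (P : finType) (le : rel P) (n m : nat).
Variables (p : P -> 'I_n.+1) (q : P -> 'I_m.+1) (pt : 'I_n.+1 -> 'I_m.+1 -> P).
Hypotheses (p_pt : forall c r, p (pt c r) = c) (q_pt : forall c r, q (pt c r) = r).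
Hypothesis pt_pq : forall x, pt (p x) (q x) = x.
Hypothesis le_pq : forall x y,
  le x y || le y x = ((p x <= p y) && (q x <= q y)) || ((p y <= p x) && (q y <= q x)).
Variable i : 'I_m.+1.

(** Columns are the fibres of [p] and rows those of [q]. A chain satisfies this exactly when it lies
    neither over the boundary of the first factor nor over the horn of the second. *)
Definition horn_full (A : {set P}) : bool :=
  [forall c : 'I_n.+1, exists x in A, p x == c] &&
  [forall r : 'I_m.+1, (r != i) ==> [exists x in A, q x == r]].

Definition prism_horn : {set {set P}} := [set A | chain le A && ~~ horn_full A].
Definition prism : {set {set P}} := [set A | chain le A].

Lemma chain_sub (A B : {set P}) : B \subset A -> chain le A -> chain le B.
Proof.
move=> /subsetP sBA /forall_inP cA; apply/forall_inP=> x /sBA xA.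
by apply/forall_inP=> y /sBA yA; move/forall_inP: (cA x xA) => /(_ y yA).
Qed.

Lemma horn_full_sub (A B : {set P}) : B \subset A -> horn_full B -> horn_full A.
Proof.
move=> /subsetP sBA /andP[/forallP h1 /forallP h2]; apply/andP; split.
  by apply/forallP=> c; have /exists_inP[x xB E] := h1 c; apply/exists_inP; exists x; rewrite ?sBA.
apply/forallP=> r; apply/implyP=> ri; have /implyP/(_ ri)/exists_inP[x xB E] := h2 r.
by apply/exists_inP; exists x; rewrite ?sBA.
Qed.

Lemma prism_horn_closed : down_closed prism_horn.
Proof.
move=> A B sBA; rewrite !inE => /andP[cA nA]; rewrite (chain_sub sBA cA).
by apply: contra nA; apply: horn_full_sub.
Qed.

Lemma prism_closed : down_closed prism.
Proof. by move=> A B sBA; rewrite !inE; apply: chain_sub. Qed.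

(* The chains outside [prism_horn] are paired by inserting or deleting the point of row [i] below
   the first point of row [i + 1].  Glueing them by increasing dimension, and for a given
   dimension by decreasing column of that point, makes each pair a horn filling. *)
Lemma prism_horn_extends_up : i < m -> extends (horn_cell le) prism prism_horn.
Proof.
move=> im; have jm : i.+1 < m.+1 by [].
pose j := Ordinal jm; have ij : i != j by rewrite -val_eqE /= ltn_eqF.
(* The first column where [A] meets row [j]; the default [ord0] is never reached for a missing
   chain, which meets every row other than [i]. *)
pose col (A : {set P}) : 'I_n.+1 :=
  odflt ord0 [pick c | (pt c j \in A) && [forall c' : 'I_n.+1, (pt c' j \in A) ==> (c <= c')]].
pose missing A := chain le A && horn_full A.
pose apex A := pt (col A) i.
have has_row A : missing A -> exists c, pt c j \in A.
  case/and3P=> _ _ /forallP/(_ j); rewrite eq_sym ij => /exists_inP[x xA /eqP xj].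
  by exists (p x); rewrite -xj pt_pq.
have colP A : missing A -> pt (col A) j \in A /\ forall c, pt c j \in A -> col A <= c.
  move=> /has_row[c0 c0A].
  rewrite /col; case: pickP => [c /andP[cA /forallP cmin]|none] /=.
    by split=> // c' c'A; have /implyP := cmin c'; apply.
  have [c cA cmin] := @arg_minnP _ c0 (fun c => pt c j \in A) (fun c => c : nat) c0A.
  have := none c; rewrite /= cA /=; case/negP; apply/forallP=> c'; apply/implyP; exact: cmin.
have colE A c : missing A -> pt c j \in A -> (forall c', pt c' j \in A -> c <= c') -> col A = c.
  move=> mA cA cmin; have [h1 h2] := colP A mA; apply: val_inj; apply/eqP.
  by rewrite eqn_leq h2 //= cmin.
have row_ne c c' : pt c j != pt c' i.
  by apply: contra ij => /eqP/(congr1 q); rewrite !q_pt => ->.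
have col_same A B : missing A -> missing B -> (forall c, (pt c j \in A) = (pt c j \in B)) ->
    col A = col B.
  move=> mA mB E; have [h1 h2] := colP B mB; apply: colE => // [|c']; first by rewrite E.
  by rewrite E; apply: h2.
have ptE (A : {set P}) c x : p x = c -> q x = j -> (pt c j \in A) = (x \in A).
  by move=> <- <-; rewrite pt_pq.
(* Let [x] be compared with the first point of row [i + 1]. In rows up to [i] it lies below that
   point, hence below the apex; in higher rows it lies above; in row [i + 1] minimality of the
   column puts it above the apex. *)
have apex_cmp A x : missing A -> x \in A -> le (apex A) x || le x (apex A).
  move=> mA xA; have [cA cmin] := colP A mA; rewrite le_pq p_pt q_pt.
  have := mA => /andP[/forall_inP/(_ _ cA)/forall_inP/(_ _ xA) + _].
  rewrite le_pq p_pt q_pt /=.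
  have := cmin (p x); case: (ltngtP (q x) i.+1) => [||E]; try by lia.
  rewrite (ptE A _ x) ?xA //; last exact: val_inj.
  by move=> /(_ isT); lia.
have le_refl x : le x x by have := le_pq x x; rewrite !leqnn /= orbb.
have missing_up A : missing A -> missing (apex A |: A).
  move=> mA; have /andP[cA fA] := mA; rewrite /missing (horn_full_sub (subsetUr _ _) fA) andbT.
  apply/forall_inP=> x /setU1P[->|xA]; apply/forall_inP=> y /setU1P[->|yA].
  - by rewrite le_refl.
  - exact: apex_cmp.
  - by rewrite orbC; apply: apex_cmp.
  - by move/forall_inP: cA => /(_ x xA)/forall_inP/(_ y yA).
(* After deleting the apex its column is still met by the point of row [j] above it, and row [i]
   need not be met. *)
have missing_down A : missing A -> missing (A :\ apex A).
  move=> mA; have /and3P[cA /forallP f1 /forallP f2] := mA.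
  rewrite /missing (chain_sub (subsetDl _ _) cA) /=; apply/andP; split.
    apply/forallP=> c; have /exists_inP[x xA xc] := f1 c; apply/exists_inP.
    have [xE|xne] := eqVneq x (apex A); last by exists x; rewrite // !inE xne.
    exists (pt (col A) j); first by rewrite !inE row_ne; case: (colP A mA).
    by rewrite -(eqP xc) xE !p_pt.
  apply/forallP=> r; apply/implyP=> ri; have /implyP/(_ ri)/exists_inP[x xA xr] := f2 r.
  apply/exists_inP; exists x => //; rewrite !inE xA andbT.
  by apply: contra ri => /eqP xE; rewrite -(eqP xr) xE q_pt.
have col_up A : missing A -> col (apex A |: A) = col A.
  by move=> mA; apply: col_same => // [|c]; [exact: missing_up | rewrite !inE (negPf (row_ne _ _))].
have col_down A : missing A -> col (A :\ apex A) = col A.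
  by move=> mA; apply: col_same => // [|c]; [exact: missing_down | rewrite !inE row_ne].
(* The invariant added to down-closure is that [K] contains the upper member of a pair whenever it
   contains the lower one; it holds vacuously for [prism_horn]. *)
suff main c (K : {set {set P}}) : #|prism :\: K| < c -> prism_horn \subset K -> K \subset prism ->
    down_closed K -> (forall A, missing A -> A \in K -> apex A |: A \in K) ->
    extends (horn_cell le) prism K.
  apply: (main _ _ (leqnn _)) => //.
  - by apply/subsetP=> A; rewrite !inE => /andP[].
  - exact: prism_horn_closed.
  - by move=> A /andP[_ fA]; rewrite inE fA andbF.
elim: c K => // c IH K; rewrite ltnS => Kc sK0 sKL Kcl Kmatch.
have out A : chain le A -> A \notin K -> missing A.
  by move=> cA nA; rewrite /missing cA; apply: contraNT nA => nA; rewrite (subsetP sK0) // inE cA.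
pose E := [set S : {set P} | [&& missing S, apex S \in S & S \notin K]].
have out_up A : chain le A -> A \notin K -> apex A |: A \in E.
  move=> cA nA; have mA := out A cA nA; rewrite inE missing_up //= /apex col_up // setU11 /=.
  by apply: contra nA; apply: Kcl; apply: subsetUr.
have [sLK|/subsetPn[A0]] := boolP (prism \subset K).
  have -> : K = prism by apply/eqP; rewrite eqEsubset sKL.
  exact: extends_refl.
rewrite inE => cA0 nA0.
(* Lexicographic order: cardinality first, then decreasing column. The weight [n.+1] exceeds every
   value of [n - col S]. *)
pose rank (S : {set P}) := #|S| * n.+1 + (n - col S).
have [S] := @arg_minnP _ _ (mem E) rank (out_up A0 cA0 nA0).
rewrite /= inE => /and3P[mS aS nS] Smin.
have /andP[cS _] := mS; have [colS colmin] := colP S mS.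
set v := apex S in aS.
have mR : missing (S :\ v) by apply: missing_down.
have aR : apex (S :\ v) = v by rewrite /apex col_down.
(* If the lower member were in [K], the invariant would put [S] there. *)
have nR : S :\ v \notin K.
  by apply: contra nS => /(Kmatch _ mR); rewrite aR setD1K.
have faces w : w \in S :\ v -> S :\ w \in K.
  case/setD1P=> wv wS; apply: contraT => nw.
  have cw : chain le (S :\ w) := chain_sub (subsetDl _ _) cS.
  have mw := out _ cw nw.
  have szw : #|S| = #|S :\ w|.+1 by rewrite (cardsD1 w S) wS.
  (* Deleting the first point of row [j] moves the column to the right; the upper member of the pair
     of [S :\ w] is then no larger than [S] and has smaller rank. *)
  have [wE|wne] := eqVneq w (pt (col S) j).
    have lt_col : col S < col (S :\ w).
      have [h _] := colP _ mw; move: h; rewrite !inE wE => /andP[h1 /colmin h2].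
      rewrite ltn_neqAle h2 andbT; apply: contra h1 => /eqP/val_inj <-; exact: eqxx.
    have := Smin _ (out_up _ cw nw); rewrite /rank col_up //.
    have : #|apex (S :\ w) |: S :\ w| <= #|S| by rewrite cardsU1 szw; case: (_ \notin _).
    move=> szU; rewrite leqNgt => /negP[]; rewrite -addnS; apply: leq_add.
      by rewrite leq_mul2r szU orbT.
    by apply: (ltn_sub2l _ lt_col); apply: (leq_trans lt_col); rewrite -ltnS.
  (* Any other deletion keeps the apex [v], so [S :\ w] is itself an upper member, of smaller
     cardinality. *)
  have colw : col (S :\ w) = col S.
    apply: colE => //; first by rewrite !inE eq_sym wne.
    by move=> c'; rewrite !inE => /andP[_ /colmin].
  have : S :\ w \in E by rewrite inE mw nw andbT /apex colw !inE eq_sym wv.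
  by move/Smin; rewrite /rank colw szw leq_add2r leq_mul2r /= ltnn.
apply: (extends_step (R := S :\ v) (S := S)) => //; first by split=> //; exists v.
  exact: subsetDl.
have sU : add_interval K (S :\ v) S \subset prism.
  rewrite subUset sKL; apply/subsetP=> A; rewrite !inE => /andP[_ sAS]; exact: chain_sub cS.
apply: IH => //.
- apply: leq_trans Kc; apply: proper_card; apply/properP; split.
    by apply: setDS; apply: subsetUl.
  by exists S; rewrite !inE ?cS ?nS // subsetDl subxx orbT.
- exact: subset_trans (subsetUl _ _).
- exact: add_interval_closed.
(* The new members are [S :\ v] and [S], both with apex [v], so the invariant persists. *)
move=> A mA; rewrite !inE => /orP[/(Kmatch _ mA) -> //|/andP[sRA sAS]].
have aA : apex A = v.
  rewrite /v /apex; congr pt; apply: col_same => // c0; apply/idP/idP=> [/(subsetP sAS) //|h].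
  by apply: (subsetP sRA); rewrite !inE h row_ne.
by rewrite aA (subset_trans sRA (subsetUr _ _)) subUset sub1set aS sAS orbT.
Qed.
End Prism.

Section PrismReverse.
Variables (P : finType) (le : rel P) (n m : nat).
Variables (p : P -> 'I_n.+1) (q : P -> 'I_m.+1) (pt : 'I_n.+1 -> 'I_m.+1 -> P).
Hypotheses (p_pt : forall c r, p (pt c r) = c) (q_pt : forall c r, q (pt c r) = r).
Hypothesis pt_pq : forall x, pt (p x) (q x) = x.
Hypothesis le_pq : forall x y,
  le x y || le y x = ((p x <= p y) && (q x <= q y)) || ((p y <= p x) && (q y <= q x)).

(* For [i = m] there is no row [i + 1], but chains are the same for the reversed order. *)
Lemma prism_horn_extends (i : 'I_m.+1) : 0 < m ->
  extends (horn_cell le) (prism le) (prism_horn le p q i).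
Proof.
move=> m0; have [im|mi] := ltnP i m; first exact: (prism_horn_extends_up p_pt q_pt pt_pq le_pq im).
have -> : prism_horn le p q i =
    prism_horn le (fun x => rev_ord (p x)) (fun x => rev_ord (q x)) (rev_ord i).
  have revE k (x y : 'I_k.+1) : (rev_ord x == y) = (x == rev_ord y) :=
    can2_eq rev_ordK rev_ordK _ _.
  have forall_rev k (F : pred 'I_k.+1) : [forall c, F c] = [forall c, F (rev_ord c)].
    apply/forallP/forallP=> h c; first exact: h.
    by have := h (rev_ord c); rewrite rev_ordK.
  apply/setP=> A; rewrite !inE; congr (_ && ~~ (_ && _)); rewrite forall_rev.
    by apply: eq_forallb => c; apply: eq_existsb => x; rewrite revE.
  by apply: eq_forallb => c; rewrite revE; congr (_ ==> _); apply: eq_existsb => x; rewrite revE.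
apply: (@prism_horn_extends_up _ _ _ _ _ _ (fun c r => pt (rev_ord c) (rev_ord r))) => /=.
- by move=> c r; rewrite p_pt rev_ordK.
- by move=> c r; rewrite q_pt rev_ordK.
- by move=> x; rewrite !rev_ordK.
(* Reversing both coordinates exchanges the two disjuncts of comparability. *)
- move=> x y; rewrite le_pq orbC; congr orb; congr andb;
  have := (ltn_ord (p x), ltn_ord (p y), ltn_ord (q x), ltn_ord (q y)); case=> [[[? ?] ?] ?]; lia.
(* Here [i] is the last row, so its reversal is row 0, which is below [m] as [0 < m]. *)
- by lia.
Qed.
End PrismReverse.

(** * Cells and matching maps *)

Definition Delta_vert N k (t : Delta N k) (i : 'I_k.+1) : 'I_N.+1 := t i.

Lemma Delta_nerve N : nerve_of (fun i j : 'I_N.+1 => i <= j) (@Delta_vert N).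
Proof.
split=> /=.
- by move=> i.
- by move=> i j /anti_leq/val_inj.
- by move=> j i k; apply: leq_trans.
- by move=> m n th t i; rewrite /Delta_vert /= ffunE.
- by move=> k t i j; apply: Dmap_mono.
- by move=> k t t'; apply: dmap_eq.
- by move=> k g /Dmap_of_mono[d dE]; exists d.
Qed.

(** The union of the faces opposite to the vertices in [I]: a common form for boundaries and
    horns. *)
Definition missing_pred N (I : {set 'I_N.+1}) k (s : Dmap k N) : bool :=
  [exists j : 'I_N.+1, (j \in I) && [forall a : 'I_k.+1, s a != j]].

Lemma missing_predE N (I : {set 'I_N.+1}) k (s : Dmap k N) :
  missing_pred I s = ~~ (I \subset supp (@Delta_vert N) s).
Proof.
apply/existsP/subsetPn=> [[j /andP[jI /forallP sj]]|[j jI js]]; exists j => //.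
  by apply/imsetP=> -[a _ E]; move: (sj a); rewrite E eqxx.
by rewrite jI; apply/forallP=> a; apply: contraNneq js => <-; apply: imset_f.
Qed.

Lemma cell_pred_missing (T : sSet) (P : finType) (vert : forall k, T k -> 'I_k.+1 -> P)
    N (e : T N) (R : {set P}) k (s : Dmap k N) :
  cell_pred vert e R s = missing_pred (vert N e @^-1: R) s.
Proof. by apply: eq_existsb => j; rewrite inE. Qed.

Lemma bd_pred_missing N k (s : Dmap k N) : bd_pred s = missing_pred setT s.
Proof. by apply: eq_existsb => j; rewrite inE. Qed.

Lemma horn_pred_missing N (i : 'I_N.+1) k (s : Dmap k N) : horn_pred i s = missing_pred [set~ i] s.
Proof. by apply: eq_existsb => j; rewrite !inE. Qed.

(** * Representability and covering properties of cells *)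

Section Covers.
Variables (D : descent) (X Y : sSpace D) (f : sSpMor X Y).

Lemma representable_ext (T : sSet) (K K' : forall k, T k -> bool) :
  (forall k t, K k t = K' k t) -> representable f K -> representable f K'.
Proof.
by move=> E [M [a [b /(represents_ext E)[a' rep _]]]]; exists M, a', b.
Qed.

Lemma cover_pred_ext N (G G' : forall k, Dmap k N -> bool) :
  (forall k s, G k s = G' k s) -> cover_pred f G -> cover_pred f G'.
Proof.
move=> E; have -> // : G' = G.
by do 2 apply: functional_extensionality_dep => ?.
Qed.

(** Every support is nonempty, so the subobject is empty and the Yoneda lemma gives [Y N]. *)
Lemma Delta_empty_representable N :
  representable f (T' := Delta N) (fun k s => supp (@Delta_vert N) s \in [set set0]).
Proof.
have no k (s : Delta N k) : supp (@Delta_vert N) s \in [set set0] -> False.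
  by rewrite inE => /eqP/setP/(_ (s ord0)); rewrite inE imset_f.
exists (Y N), (fun k s h => False_rect _ (no k s h)), (fun k s => spmap Y s); split.
  split=> [m n th s h|m n th s|k s h]; try by case: (no _ _ h).
  exact: spmap_comp.
move=> U a b [_ bn _]; exists (b N (did N)); split.
  split=> [k s h|k s]; first by case: (no _ _ h).
  rewrite -bn; congr b.
  by apply: dmap_eq => i; rewrite /= !ffunE.
by move=> h [_ /(_ N (did N))]; rewrite spmap_id comp_idl.
Qed.

(** Induction on [N]: the union of faces is built from the empty complex by glueing along
    boundaries. Its simplices miss a vertex, so the cells have dimension below [N] and their
    boundaries are representable by induction. *)
Lemma missing_representable N (I : {set 'I_N.+1}) : I != set0 ->
  representable f (T' := Delta N) (missing_pred I).
Proof.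
have [c] := ubnP N; elim: c N I => // c IH N I; rewrite ltnS => Nc I0.
pose L := [set A : {set 'I_N.+1} | ~~ (I \subset A)].
apply: (@representable_ext _ (fun k s => supp (@Delta_vert N) s \in L)).
  by move=> k s; rewrite missing_predE inE.
have [M [a [b rep]]] := Delta_empty_representable N.
have [|||||M' [a' [b' [_ [rep' _ _ _]]]]] :=
  extends_represents (Delta_nerve N)
    (Q := fun R S => boundary_cell (fun i j : 'I_N.+1 => i <= j) R S /\ #|S| <= N) (L := L)
    _ _ _ _ _ rep; last by exists M', a', b'.
- by move=> R S [[]].
- move=> R S k e [[_ ->] SN] einj eS _ _.
  apply: (@representable_ext (Delta k) _ _ (fun j s => esym (cell_pred_missing _ e S s))).
  apply: IH; first apply: leq_trans Nc.
    by move: SN; rewrite -eS card_imset // card_ord.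
  by apply/set0Pn; exists ord0; rewrite inE -eS imset_f.
- apply: boundary_extends.
  + by move=> A B sBA; rewrite !inE => /eqP E; rewrite -subset0 -E.
  + by move=> A B sBA; rewrite !inE; apply: contra => /subset_trans; apply.
  + by rewrite sub1set inE subset0.
  + move=> S; rewrite inE => nIS; split.
      by apply/forall_inP=> x _; apply/forall_inP=> y _; apply: leq_total.
    have [w _ wS] := subsetPn nIS.
    have /proper_card : S \proper [set: 'I_N.+1] by apply/properP; split=> //; exists w.
    by rewrite cardsT card_ord.
- by move=> A B sBA; rewrite !inE => /eqP E; rewrite -subset0 -E.
- by rewrite inE.
Qed.

(** Currying: a cone on the subtype [SubDelta] is a cone with explicit membership proofs. *)
Lemma matching_cover_pred N (G : forall k, Dmap k N -> bool)
    (Gcl : forall k m (th : Dmap k m) s, G m s -> G k (dcomp s th)) :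
  matching_cover f (SubDelta_incl Gcl) -> cover_pred f G.
Proof.
move=> mc H aH bH [[an bn fab] univ] h ha hb.
apply: (mc H (fun k s => aH k _ (proj2_sig s)) bH) => //.
  split=> // [m n th [s g]|U a' b' a'n b'n fab'] /=; first exact: an.
  have [|r [[ra rb] ru]] := univ U (fun k s g => a' k (exist _ s g)) b'.
    split=> // m n th s g g'.
    rewrite -a'n; congr a'; exact: sig_eqb.
  exists r; split; first by split=> // k [s g]; apply: ra.
  by move=> r' [r'a r'b]; apply: ru; split=> // k s g; rewrite -(r'a k (exist _ s g)).
Qed.

Section Cells.
Variables (T : sSet) (P : finType) (vert : forall k, T k -> 'I_k.+1 -> P).

Lemma cell_representable N (e : T N) (R : {set P}) : R != set0 -> R \subset supp vert e ->
  @representable D X Y f (Delta N) (cell_pred vert e R).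
Proof.
move=> /set0Pn[w wR] /subsetP sRe.
apply: (@representable_ext (Delta N) _ _ (fun j s => esym (cell_pred_missing _ e R s))).
have /imsetP[j _ E] := sRe w wR.
by apply: missing_representable; apply/set0Pn; exists j; rewrite inE -E.
Qed.

Lemma hypercover_cell N (e : T N) : hypercover f -> cover_pred f (cell_pred vert e (supp vert e)).
Proof.
move=> hc; apply: cover_pred_ext (matching_cover_pred (hc N)) => k s.
rewrite bd_pred_missing cell_pred_missing; congr (missing_pred _ s).
by apply/setP=> j; rewrite !inE imset_f.
Qed.

(** Removing [v] from the support leaves the horn at the index of [v]; a second vertex ensures
    [0 < N]. *)
Lemma fibration_cell N (e : T N) v : fibration f -> injective (vert e) ->
  v \in supp vert e -> supp vert e :\ v != set0 ->
  cover_pred f (cell_pred vert e (supp vert e :\ v)).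
Proof.
move=> fib einj /imsetP[i _ ->] /set0Pn[x /setD1P[ne /imsetP[j _ E]]].
have N0 : 0 < N.
  rewrite lt0n; apply: contraNneq ne => N0; rewrite E; apply/eqP; congr vert; apply: val_inj.
  have small (l : 'I_N.+1) : l = 0 :> nat by apply/eqP; rewrite -leqn0 -N0 -ltnS.
  by rewrite /= !small.
apply: cover_pred_ext (matching_cover_pred (fib N i N0)) => k s.
rewrite horn_pred_missing cell_pred_missing; congr (missing_pred _ s).
by apply/setP=> l; rewrite !inE imset_f // andbT (inj_eq einj).
Qed.
End Cells.
End Covers.

(** * The exponential law for path spaces *)

Lemma dcomp_id_l m n (s : Dmap m n) : dcomp (did n) s = s.
Proof. by apply: dmap_eq => i; rewrite /= !ffunE. Qed.

Lemma IsMap_uniq (V : Cat) (T : sSet) (X : sSpace V) (M U : V)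
    (c : forall k, T k -> Hom M (X k)) (h1 h2 : Hom U M) :
  IsMap M c -> (forall k t, comp (c k t) h1 = comp (c k t) h2) -> h1 = h2.
Proof.
move=> [cn univ] E.
have [|h [_ hu]] := univ U (fun k t => comp (c k t) h2).
  by move=> m n th t; rewrite cn comp_assoc.
by rewrite -(hu h1) // -(hu h2).
Qed.

Lemma pullback_uniq (V : Cat) (A B C P U : V) (a : Hom A C) (b : Hom B C)
    (p1 : Hom P A) (p2 : Hom P B) (h1 h2 : Hom U P) : is_pullback a b p1 p2 ->
  comp p1 h1 = comp p1 h2 -> comp p2 h1 = comp p2 h2 -> h1 = h2.
Proof.
move=> [sq univ] E1 E2; have [|h [_ hu]] := univ U (comp p1 h2) (comp p2 h2).
  by rewrite !comp_assoc sq.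
by rewrite -(hu h1) // -(hu h2).
Qed.

Section PathSpace.
Variables (V : Cat) (T : sSet) (X Z : sSpace V).
Variable u : forall m j, sprod T (Delta m) j -> Hom (Z m) (X j).
Hypothesis uP : IsPT u.

Lemma path_cone m j k (t : T j) (d : Dmap j m) (th : Dmap k j) :
  u (sact T th t, dcomp d th) = comp (spmap X th) (u (t, d)).
Proof. by have [/(_ m)[cn _] _] := uP; have := cn _ _ th (t, d). Qed.

(** By naturality of [z], the transposed family is determined by its values at identity simplices of
    the second factor. *)
Lemma path_restrict (U : V) m (z : forall k, Dmap k m -> Hom U (Z k)) :
  (forall k l (th : Dmap k l) d, z k (dcomp d th) = comp (spmap Z th) (z l d)) ->
  forall k j (t : T j) (e : Dmap j k) (d : Dmap k m),
  comp (u (t, e)) (z k d) = comp (u (t, did j)) (z j (dcomp d e)).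
Proof.
move=> zn k j t e d; rewrite zn comp_assoc; have [_ ->] := uP.
by rewrite dcomp_id_r.
Qed.
End PathSpace.

Section Bridge.
Variables (D : descent) (X Y : sSpace D) (f : sSpMor X Y) (n m : nat).
Variable SP : forall k, Dmap k n -> bool.
Hypothesis Scl : forall k l (th : Dmap k l) s, SP s -> SP (dcomp s th).
Variable RP : forall k, Dmap k m -> bool.
Hypothesis Rcl : forall k l (th : Dmap k l) s, RP s -> RP (dcomp s th).
Variables (Z W : sSpace D) (g : sSpMor Z W).

Let T := sprod (Delta n) (Delta m).
Definition corner_pred k (x : T k) : bool := SP x.1 || RP x.2.

(* Exponential law: a map from [Delta m] to [W] is a pair of compatible maps
   [S x Delta m -> X] and [Delta n x Delta m -> Y], and a map from [R] to [Z] is a map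
   [Delta n x R -> X]. *)
Lemma corner_represents (M : D) a b (h : Hom (Z m) M) :
  induced_path_map f (SubDelta_incl Scl) g ->
  IsRelMap (SubDelta_incl Rcl) g M a b ->
  (forall k s, comp (a k s) h = spmap Z (SubDelta_incl Rcl k s)) ->
  (forall k (t : Dmap k m), comp (b k t) h = comp (g k) (spmap Z t)) ->
  exists A B uZ uY,
    [/\ @represents D X Y f T corner_pred M A B,
        @represents D X Y f T (fun _ _ => true) (Z m) uZ uY,
        forall k x H H', comp (A k x H) h = uZ k x H' &
        forall k x, comp (B k x) h = uY k x].
Proof.
move=> [uTX [ZSX [uSX [ZSY [uSY [ZTY [uTY [p1 [p2 [fS [rY]]]]]]]]]]].
move=> [[PTX PSX PSY PTY] [[fSE rYE pbW] [p1g p2g]]] [an bn gab univM] ha hb.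
have bn' k l (th : Dmap k l) d : b k (dcomp d th) = comp (spmap W th) (b l d) by apply: bn.
pose S := SubDelta Scl; pose R := SubDelta Rcl.
have p1g' l j (s : S j) (d : Dmap j l) :
    comp (comp (uSX l j (s, d)) (p1 l)) (g l) = uTX l j (sval s, d) by rewrite -comp_assoc p1g.
have p2g' l j (t : Dmap j n) (d : Dmap j l) :
    comp (comp (uTY l j (t, d)) (p2 l)) (g l) = comp (f j) (uTX l j (t, d)).
  by rewrite -comp_assoc p2g.
have sqW l j (s : S j) (d : Dmap j l) :
    comp (comp (f j) (uSX l j (s, d))) (p1 l) = comp (uTY l j (sval s, d)) (p2 l).
  by rewrite -fSE -[uTY _ _ _]rYE -!comp_assoc; case: (pbW l) => ->.
pose zS k d := comp (p1 k) (b k d); pose zT k d := comp (p2 k) (b k d).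
have zSn k l (th : Dmap k l) d : zS k (dcomp d th) = comp (spmap ZSX th) (zS l d).
  by rewrite /zS bn' !comp_assoc smor_nat.
have zTn k l (th : Dmap k l) d : zT k (dcomp d th) = comp (spmap ZTY th) (zT l d).
  by rewrite /zT bn' !comp_assoc smor_nat.
have LS := path_restrict PSX zSn; have LT := path_restrict PTY zTn.
have LR k j (t : Dmap j n) (e : Dmap j k) (d : R k) :
    comp (uTX k j (t, e)) (a k d) = comp (uTX j j (t, did j)) (a j (sact R e d)).
  by rewrite an comp_assoc; have [_ ->] := PTX; rewrite dcomp_id_r.
(* The component in [X] comes from [b] through [W] over [S], and from [a] through [Z] over [R]; the
   compatibility [gab] makes them agree on the overlap. *)
have /(fun E => constructive_indefinite_description _ E) [A AP] :
    exists A : forall k x, @corner_pred k x -> Hom M (X k), forall k x H,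
      (forall s : S k, sval s = x.1 -> A k x H = comp (uSX k k (s, did k)) (zS k x.2)) /\
      (forall d : R k, sval d = x.2 -> A k x H = comp (uTX k k (x.1, did k)) (a k d)).
  suff ex k x (H : @corner_pred k x) : exists y : Hom M (X k),
      (forall s : S k, sval s = x.1 -> y = comp (uSX k k (s, did k)) (zS k x.2)) /\
      (forall d : R k, sval d = x.2 -> y = comp (uTX k k (x.1, did k)) (a k d)).
    by exists (fun k x H => proj1_sig (constructive_indefinite_description _ (ex k x H))) => k x H;
       case: constructive_indefinite_description.
  case: x H => t d /= H; have [hs|nhs] := orP (orbN (SP t)).
    exists (comp (uSX k k (exist _ t hs, did k)) (zS k d)); split=> [s E|r E].
      by congr (comp (uSX _ _ (_, _)) _); apply: sig_eqb.
    by rewrite /zS /= -E -[sval r]/(SubDelta_incl Rcl k r) -gab !comp_assoc p1g'.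
  have hr : RP d by move: H; rewrite /corner_pred /= (negPf nhs).
  exists (comp (uTX k k (t, did k)) (a k (exist _ d hr))); split=> [s E|r E].
    by move: nhs; rewrite -E (proj2_sig s).
  by congr (comp _ (a _ _)); apply: sig_eqb.
have AS k x H (s : S k) : sval s = x.1 -> A k x H = comp (uSX k k (s, did k)) (zS k x.2).
  by case: (AP k x H) => + _; apply.
have AR k x H (d : R k) : sval d = x.2 -> A k x H = comp (uTX k k (x.1, did k)) (a k d).
  by case: (AP k x H) => _; apply.
pose B k (x : T k) := comp (uTY k k (x.1, did k)) (zT k x.2).
have cornerP k (x : T k) : corner_pred x ->
    (exists s : S k, sval s = x.1) \/ (exists d : R k, sval d = x.2).
  case/orP=> H; [left | right].
    by exists (exist (fun s : Dmap k n => SP s) x.1 H).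
  by exists (exist (fun d : Dmap k m => RP d) x.2 H).
exists A, B, (fun k x _ => uTX m k x), (fun k x => comp (f k) (uTX m k x)); split.
- split.
    split=> [k l th x H H'|k l th [t d]|k x H].
    + have [[s E]|[r E]] := cornerP _ _ H.
        rewrite (AS _ _ H' (sact S th s)) /= ?E // (AS _ _ H s E) comp_assoc -(path_cone PSX).
        by rewrite dcomp_id_l; symmetry; apply: LS.
      rewrite (AR _ _ H' (sact R th r)) /= ?E // (AR _ _ H r E) comp_assoc -(path_cone PTX).
      by rewrite dcomp_id_l; symmetry; apply: LR.
    + by rewrite /B /= comp_assoc -(path_cone PTY) dcomp_id_l; symmetry; apply: LT.
    + have [[s E]|[r E]] := cornerP _ _ H.
        by rewrite (AS _ _ H s E) /B /zT /zS -E !comp_assoc sqW.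
      rewrite (AR _ _ H r E) /B /zT -E -[sval r]/(SubDelta_incl Rcl k r) -gab.
      by rewrite !comp_assoc p2g'.
  move=> U A' B' [A'n B'n fA'].
  have cS k (s : S k) (d : Dmap k m) : @corner_pred k (sval s, d).
    by rewrite /corner_pred /= (proj2_sig s).
  have cR k (t : Dmap k n) (r : R k) : @corner_pred k (t, sval r).
    by rewrite /corner_pred /= (proj2_sig r) orbT.
  have A'E k x x' H H' : x = x' -> A' k x H = A' k x' H'.
    by move=> E; subst x'; congr A'; apply: bool_irrelevance.
  have A'act k l (th : Dmap k l) x x' H H' :
      x' = sact T th x -> A' k x' H' = comp (spmap X th) (A' l x H).
    by move=> E; subst x'; apply: A'n.
  (* Transpose of the part of [A'] over [R], with values in [Z]. *)
  have exalpha k (r : R k) : exists z : Hom U (Z k), forall j t (e : Dmap j k),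
      comp (uTX k j (t, e)) z = A' j _ (cR j t (sact R e r)).
    have [/(_ k)[_ univ] _] := PTX.
    have [|z [zE _]] := univ U (fun j (x : sprod (Delta n) (Delta k) j) =>
        A' j _ (cR j x.1 (sact R x.2 r))); last by exists z => j t e; rewrite zE.
    by move=> j l th [t e] /=; apply: A'act; rewrite /= dcomp_assoc.
  pose alpha k r := proj1_sig (constructive_indefinite_description _ (exalpha k r)).
  have alphaE k r j t (e : Dmap j k) :
      comp (uTX k j (t, e)) (alpha k r) = A' j _ (cR j t (sact R e r)).
    by rewrite /alpha; case: constructive_indefinite_description.
  (* Transpose of [B'] and of the part of [A'] over [S], paired into the fibre product [W]. *)
  have exbeta k (d : Dmap k m) : exists w : Hom U (W k),
      (forall j (s : S j) (e : Dmap j k),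
         comp (comp (uSX k j (s, e)) (p1 k)) w = A' j _ (cS j s (dcomp d e))) /\
      (forall j (t : Dmap j n) (e : Dmap j k),
         comp (comp (uTY k j (t, e)) (p2 k)) w = B' j (t, dcomp d e)).
    have [/(_ k)[_ univ1] _] := PSX; have [/(_ k)[_ univ2] _] := PTY.
    have [|z1 [z1E _]] := univ1 U (fun j (x : sprod S (Delta k) j) =>
        A' j _ (cS j x.1 (dcomp d x.2))).
      by move=> j l th [s e] /=; apply: A'act; rewrite /= dcomp_assoc.
    have [|z2 [z2E _]] := univ2 U (fun j (x : sprod (Delta n) (Delta k) j) =>
        B' j (x.1, dcomp d x.2)).
      by move=> j l th [t e] /=; rewrite -B'n /= dcomp_assoc.
    have [_ univW] := pbW k; have [|w [[w1 w2] _]] := univW U z1 z2.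
      apply: (IsMap_uniq (proj1 PSY k)) => j [s e].
      by rewrite !comp_assoc fSE rYE z2E -comp_assoc z1E fA'.
    by exists w; split=> j ? e; rewrite -comp_assoc ?w1 ?w2 ?z1E ?z2E.
  pose beta k d := proj1_sig (constructive_indefinite_description _ (exbeta k d)).
  have betaS k d j s (e : Dmap j k) :
      comp (comp (uSX k j (s, e)) (p1 k)) (beta k d) = A' j _ (cS j s (dcomp d e)).
    by rewrite /beta; case: constructive_indefinite_description => w [].
  have betaT k d j t (e : Dmap j k) :
      comp (comp (uTY k j (t, e)) (p2 k)) (beta k d) = B' j (t, dcomp d e).
    by rewrite /beta; case: constructive_indefinite_description => w [].
  (* Maps into [W k] are detected by the universal cones of the two path spaces. *)
  have Wext k (w w' : Hom U (W k)) :
      (forall j s (e : Dmap j k), comp (comp (uSX k j (s, e)) (p1 k)) w =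
         comp (comp (uSX k j (s, e)) (p1 k)) w') ->
      (forall j t (e : Dmap j k), comp (comp (uTY k j (t, e)) (p2 k)) w =
         comp (comp (uTY k j (t, e)) (p2 k)) w') -> w = w'.
    move=> E1 E2; apply: (pullback_uniq (pbW k)).
      by apply: (IsMap_uniq (proj1 PSX k)) => j [s e]; rewrite !comp_assoc E1.
    by apply: (IsMap_uniq (proj1 PTY k)) => j [s e]; rewrite !comp_assoc E2.
  have [|||r0 [[r0a r0b] r0u]] := univM U alpha beta.
  - move=> k l th r; apply: (IsMap_uniq (proj1 PTX k)) => j [t e].
    rewrite comp_assoc (proj2 PTX) !alphaE; apply: A'E.
    by rewrite /= dcomp_assoc.
  - move=> k l th d; apply: Wext => j t e.
      rewrite betaS comp_assoc -[comp _ (spmap W th)]comp_assoc smor_nat comp_assoc (proj2 PSX).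
      rewrite betaS.
      by apply: A'E; rewrite /= dcomp_assoc.
    rewrite betaT comp_assoc -[comp _ (spmap W th)]comp_assoc smor_nat comp_assoc (proj2 PTY) betaT.
    by rewrite /= dcomp_assoc.
  - move=> k r; apply: Wext => j t e.
      by rewrite comp_assoc p1g' alphaE betaS; apply: A'E.
    by rewrite comp_assoc p2g' -comp_assoc alphaE fA' betaT.
  exists r0; split.
    split=> [k x H|k [t d]].
      have [[s E]|[r E]] := cornerP _ _ H.
        rewrite (AS _ _ H s E) /zS -!comp_assoc r0b comp_assoc betaS; apply: A'E.
        by rewrite dcomp_id_r E -surjective_pairing.
      rewrite (AR _ _ H r E) -comp_assoc r0a alphaE; apply: A'E.
      by rewrite /= dcomp_id_r E -surjective_pairing.
    by rewrite /B /zT -!comp_assoc r0b comp_assoc betaT dcomp_id_r.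
  move=> r' [r'A r'B]; apply: r0u; split=> [k r|k d].
    apply: (IsMap_uniq (proj1 PTX k)) => j [t e].
    rewrite alphaE comp_assoc LR -(r'A _ _ (cR _ _ _)).
    by rewrite (AR _ _ _ (sact R e r)).
  apply: Wext => j t e.
    rewrite betaS -(r'A _ _ (cS _ _ _)) (AS _ _ _ t) // comp_assoc.
    by rewrite -[comp _ (b k d)]comp_assoc LS.
  rewrite betaT -r'B comp_assoc.
  by rewrite -[comp _ (b k d)]comp_assoc LT.
(* On the whole product the component in [Y] is the image under [f] of the one in [X], so relative
   cones are just cones over [X]. *)
- split.
    split=> [k l th [t d] _ _|k l th [t d]|k x _] //; first exact: (path_cone PTX).
    by rewrite comp_assoc -smor_nat -comp_assoc -(path_cone PTX).
  move=> U a' b' [a'n b'n fa'].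
  have [/(_ m)[_ univ] _] := PTX.
  have [|z [zE zu]] := univ U (fun k x => a' k x isT); first by move=> k l th x; apply: a'n.
  exists z; split.
    split=> [k x H|k x]; last by rewrite -comp_assoc zE fa'.
    by rewrite zE; congr a'; apply: bool_irrelevance.
  by move=> z' [z'a _]; apply: zu => k x; apply: z'a.
- move=> k [t d] H _; have [[s E]|[r E]] := cornerP _ _ H.
    rewrite (AS _ _ H s E) /zS -!comp_assoc hb !comp_assoc p1g' (proj2 PTX) /=.
    by rewrite dcomp_id_r E.
  rewrite (AR _ _ H r E) -comp_assoc ha (proj2 PTX) /= dcomp_id_r.
  by rewrite E.
- move=> k [t d]; rewrite /B /zT -!comp_assoc hb !comp_assoc p2g' -comp_assoc (proj2 PTX) /=.
  by rewrite dcomp_id_r.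
Qed.
End Bridge.

(** * Products of simplices *)

Section ProductNerve.
Variables n m : nat.

Definition prod_le : rel ('I_n.+1 * 'I_m.+1) := fun x y => (x.1 <= y.1) && (x.2 <= y.2).

Definition prod_vert k (x : sprod (Delta n) (Delta m) k) (i : 'I_k.+1) : 'I_n.+1 * 'I_m.+1 :=
  (Delta_vert x.1 i, Delta_vert x.2 i).

Lemma prod_nerve : nerve_of prod_le prod_vert.
Proof.
split.
- by move=> x; rewrite /prod_le !leqnn.
- move=> [x1 x2] [y1 y2] /andP[/andP[/= h1 h2] /andP[/= h3 h4]].
  by congr pair; apply: val_inj; apply/eqP; rewrite eqn_leq ?h1 ?h2.
- move=> y x z /andP[h1 h2] /andP[h3 h4].
  by rewrite /prod_le (leq_trans h1 h3) (leq_trans h2 h4).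
- by move=> k l th x i; rewrite /prod_vert !(vert_act (Delta_nerve _)).
- by move=> k x i j ij; rewrite /prod_le !(vert_mono (Delta_nerve _)).
- move=> k [s d] [s' d'] E; congr pair; apply: (vert_inj (Delta_nerve _)) => i.
    by case: (E i).
  by case: (E i).
- move=> k v vm.
  have [i j /vm/andP[] //|s sE] := @Dmap_of_mono k n (fun i => (v i).1).
  have [i j /vm/andP[] //|d dE] := @Dmap_of_mono k m (fun i => (v i).2).
  by exists (s, d) => i; rewrite /prod_vert /Delta_vert /= sE dE -surjective_pairing.
Qed.

Lemma supp_exists (I : eqType) (c : I) (pr : 'I_n.+1 * 'I_m.+1 -> I) k
    (x : sprod (Delta n) (Delta m) k) :
  [exists y in supp prod_vert x, pr y == c] = [exists a, pr (prod_vert x a) == c].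
Proof.
apply/exists_inP/existsP=> [[_ /imsetP[a _ ->] E]|[a E]]; first by exists a.
by exists (prod_vert x a) => //; apply: imset_f.
Qed.

(** The chains lying over the boundary of at least one factor. *)
Definition prism_bd : {set {set 'I_n.+1 * 'I_m.+1}} :=
  [set A | chain prod_le A && ~~ ([forall c, exists x in A, x.1 == c] &&
     [forall c, exists x in A, x.2 == c])].

Lemma prism_bd_closed : down_closed prism_bd.
Proof.
move=> A B sBA; rewrite !inE => /andP[cA nA]; rewrite (chain_sub sBA cA).
apply: contra nA => /andP[/forallP h1 /forallP h2]; apply/andP; split; apply/forallP=> c.
  by have /exists_inP[x xB E] := h1 c; apply/exists_inP; exists x; rewrite ?(subsetP sBA).
by have /exists_inP[x xB E] := h2 c; apply/exists_inP; exists x; rewrite ?(subsetP sBA).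
Qed.
End ProductNerve.

Lemma bd_predN n k (s : Dmap k n) : ~~ bd_pred s = [forall c, exists a, s a == c].
Proof.
rewrite negb_exists; apply: eq_forallb => c; rewrite negb_forall.
by apply: eq_existsb => a; rewrite negbK.
Qed.

Lemma horn_predN n (i : 'I_n.+1) k (s : Dmap k n) :
  ~~ horn_pred i s = [forall c, (c != i) ==> [exists a, s a == c]].
Proof.
rewrite negb_exists; apply: eq_forallb => c; rewrite negb_and negb_forall implybE.
by congr (_ || _); apply: eq_existsb => a; rewrite negbK.
Qed.

(** * Matching maps of induced path maps *)

Section Corner.
Variables (D : descent) (X Y : sSpace D) (f : sSpMor X Y) (n m : nat).
Variable SP : forall k, Dmap k n -> bool.
Hypothesis Scl : forall k l (th : Dmap k l) s, SP s -> SP (dcomp s th).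
Variable RP : forall k, Dmap k m -> bool.
Hypothesis Rcl : forall k l (th : Dmap k l) s, RP s -> RP (dcomp s th).
Variables (Z W : sSpace D) (g : sSpMor Z W).

(** Glueing from the corner to the whole product yields a cover [r]. Its source and [Z m] represent
    the same functor, so the matching map is [r] after an isomorphism. *)
Lemma corner_cover (Q : {set 'I_n.+1 * 'I_m.+1} -> {set 'I_n.+1 * 'I_m.+1} -> Prop)
    (K : {set {set 'I_n.+1 * 'I_m.+1}}) :
  induced_path_map f (SubDelta_incl Scl) g ->
  (forall k (x : sprod (Delta n) (Delta m) k),
     (supp (@prod_vert n m) x \in K) = corner_pred SP RP x) ->
  down_closed K -> set0 \in K -> extends Q (prism (@prod_le n m)) K ->
  (forall R S, Q R S -> chain (@prod_le n m) S) ->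
  (forall R S N (e : sprod (Delta n) (Delta m) N), Q R S -> injective (prod_vert e) ->
     supp (@prod_vert n m) e = S -> R != set0 -> cover_pred f (cell_pred (@prod_vert n m) e R)) ->
  matching_cover g (SubDelta_incl Rcl).
Proof.
move=> ind KE Kcl K0 KL Qchain Qcov M a b relM h ha hb.
have [A [B [uZ [uY [repM repZ Ah Bh]]]]] := corner_represents ind relM ha hb.
have [A1 repM1 A1E] := represents_ext (fun k x => esym (KE k x)) repM.
have [|M' [a' [b' [r [repM' ra rb rcov]]]]] :=
  extends_represents (prod_nerve n m) Qchain _ KL Kcl K0 repM1.
  by move=> R S N e _ _ eS sRS R0; apply: cell_representable => //; rewrite eS.
have full k (x : sprod (Delta n) (Delta m) k) :
    (supp (@prod_vert n m) x \in prism (@prod_le n m)) = true.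
  by rewrite inE (supp_chain (prod_nerve n m)).
have [a2 repM2 a2E] := represents_ext full repM'.
have [u [ucov ua ub]] := represents_iso repZ repM2.
have -> : h = comp r u.
  apply: (represents_uniq repM1) => [k x H|k x]; last by rewrite Bh comp_assoc rb ub.
  have H1 : corner_pred SP RP x by rewrite -KE.
  rewrite comp_assoc (ra _ _ _ (full k x)) -(a2E _ _ (full k x) isT) ua.
  by rewrite (A1E _ _ H1) (Ah _ _ _ isT).
by apply: cover_comp => //; apply: rcov.
Qed.
End Corner.

Lemma prism_horn0 (P : finType) (le : rel P) n m (p : P -> 'I_n.+1) (q : P -> 'I_m.+1) i :
  set0 \in prism_horn le p q i.
Proof.
rewrite inE; apply/andP; split; first by apply/forall_inP=> x; rewrite inE.
by apply/negP=> /andP[/forallP/(_ ord0)/exists_inP[x]]; rewrite inE.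
Qed.

Theorem theorem3p21 (D : descent) (X Y : sSpace D) (f : sSpMor X Y) :
  (forall (n : nat) (Z W : sSpace D) (g : sSpMor Z W),
      induced_path_map f (bd_incl n) g ->
      (fibration f -> fibration g) /\ (hypercover f -> hypercover g)) /\
  (forall (n : nat) (i : 'I_n.+1), 0 < n ->
     forall (Z W : sSpace D) (g : sSpMor Z W),
      induced_path_map f (horn_incl i) g ->
      fibration f -> hypercover g).
Proof.
split=> [n Z W g ind|n i n0 Z W g ind fib m].
  split=> [fib m i m0|hyp m].
    (* Boundary in the first factor, horn in the second. *)
    apply: (corner_cover (K := prism_horn (@prod_le n m) fst snd i)
      (Q := horn_cell (@prod_le n m)) ind).
    - move=> k x; rewrite inE (supp_chain (prod_nerve n m)) /corner_pred -[RHS]negbK negb_or.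
      rewrite bd_predN horn_predN; congr (~~ (_ && _)); apply: eq_forallb => c.
        exact: supp_exists.
      by rewrite supp_exists.
    - exact: prism_horn_closed.
    - exact: prism_horn0.
    - by apply: (@prism_horn_extends _ _ _ _ fst snd pair) => // [[]].
    - by move=> R S [].
    - by move=> R S N e [_ [v vS ->]] einj eS; rewrite -eS in vS *; apply: fibration_cell.
  (* The dimension bound is the trivial one, the size of the whole poset. *)
  apply: (corner_cover (K := prism_bd n m)
    (Q := fun R S => boundary_cell (@prod_le n m) R S /\ #|S| <= #|{: 'I_n.+1 * 'I_m.+1}|) ind).
  - move=> k x; rewrite inE (supp_chain (prod_nerve n m)) /corner_pred -[RHS]negbK negb_or.
    by rewrite !bd_predN; congr (~~ (_ && _)); apply: eq_forallb => c; apply: supp_exists.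
  - exact: prism_bd_closed.
  - rewrite inE; apply/andP; split; first by apply/forall_inP=> x; rewrite inE.
    by apply/negP=> /andP[/forallP/(_ ord0)/exists_inP[x]]; rewrite inE.
  - apply: boundary_extends; first exact: prism_bd_closed.
    + exact: prism_closed.
    + by apply/subsetP=> A; rewrite !inE => /andP[].
    + by move=> S; rewrite inE => cS; split=> //; apply: max_card.
  - by move=> R S [[]].
  - by move=> R S N e [[_ ->] _] _ <- _; apply: hypercover_cell.
(* The horn is now in the first factor, so rows and columns exchange roles. *)
apply: (corner_cover (K := prism_horn (@prod_le n m) snd fst i)
  (Q := horn_cell (@prod_le n m)) ind).
- move=> k x; rewrite inE (supp_chain (prod_nerve n m)) /corner_pred orbC -[RHS]negbK negb_or.
  rewrite bd_predN horn_predN; congr (~~ (_ && _)); apply: eq_forallb => c.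
    exact: supp_exists.
  by rewrite supp_exists.
- exact: prism_horn_closed.
- exact: prism_horn0.
- apply: (@prism_horn_extends _ _ _ _ snd fst (fun c r => (r, c))) => // [[] //|x y].
  by rewrite /prod_le; congr orb; apply: andbC.
- by move=> R S [].
- by move=> R S N e [_ [v vS ->]] einj eS; rewrite -eS in vS *; apply: fibration_cell.
Qed.
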